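(* Let $n\ge 1$ and let $\Delta=(\Delta_{ij})$ be an integer $n\times n$ matrix such that $\det\Delta\neq 0$, $\Delta_{ij}\le 0$ for all $i\ne j$, and there exists a vector $\mathbf r\in\mathbb Z^n$ with $\mathbf r>0$ and $\mathbf r\Delta\ge 0$. Let $\mathbf r\in\mathscr R(\Delta)$ and suppose $f$ and $f'$ are two $(\Delta,\mathbf r)$-parking functions. If $f'-f\in\langle\Delta\rangle$, then $f'=f$.
   Context: Vectors are row vectors. $\mathbf r>0$ means $r_i>0$ for all $i$; $\mathbf r\ge \mathbf r'$ means $r_i\ge r'_i$ for all $i$. $\mathscr R(\Delta)=\{\mathbf r\in\mathbb Z^n : \mathbf r>0,\ \mathbf r\Delta\ge 0\}$. For $\mathbf r\in\mathscr R(\Delta)$, $\Omega(\mathbf r)$ is the set of integer vectors $\chi=(\chi(1),\dots,\chi(n))$ with $0\le\chi(i)\le r_i$ for every $i$ and $\chi(i)\ne 0$ for some $i$. $\Delta^j$ is the $j$-th column of $\Delta$, and $\langle X,Y\rangle=\sum_{i=1}^n X_iY_i$. A $(\Delta,\mathbf r)$-parking function is a function $f:\{1,\dots,n\}\to\{0,1,2,\dots\}$ such that for every $\chi\in\Omega(\mathbf r)$ there exists $j$ with $\chi(j)\ge 1$ and $0\le f(j)<\langle\chi,\Delta^j\rangle$. A function $f$ on $\{1,\dots,n\}$ is identified with the vector $(f(1),\dots,f(n))$. $\langle\Delta\rangle=\mathbb Z\Delta_1\oplus\cdots\oplus\mathbb Z\Delta_n$ is the sublattice of $\mathbb Z^n$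 spanned by the rows $\Delta_1,\dots,\Delta_n$ of $\Delta$. *)

(* Defs.v *)
From mathcomp Require Import all_boot all_order all_algebra.

Set Implicit Arguments.
Unset Strict Implicit.
Unset Printing Implicit Defensive.

Import Order.TTheory GRing.Theory Num.Theory.
Local Open Scope ring_scope.

Definition vec_pos (n : nat) (r : 'rV[int]_n) : Prop := forall i, 0 < r 0 i.

Definition vec_ge (n : nat) (r s : 'rV[int]_n) : Prop :=
  forall i, s 0 i <= r 0 i.

Definition in_R (n : nat) (Delta : 'M[int]_n) (r : 'rV[int]_n) : Prop :=
  vec_pos r /\ vec_ge (r *m Delta) 0.

Definition in_Omega (n : nat) (r chi : 'rV[int]_n) : Prop :=
  (forall i, 0 <= chi 0 i <= r 0 i) /\ (exists i, chi 0 i != 0).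

Definition pairing (n : nat) (X : 'rV[int]_n) (Y : 'cV[int]_n) : int :=
  \sum_i X 0 i * Y i 0.

Definition parking_function (n : nat) (Delta : 'M[int]_n) (r : 'rV[int]_n)
    (f : {ffun 'I_n -> nat}) : Prop :=
  forall chi : 'rV[int]_n, in_Omega r chi ->
    exists j, 1 <= chi 0 j /\ 0 <= (f j)%:Z < pairing chi (col j Delta).

Definition vec_of_fun (n : nat) (f : {ffun 'I_n -> nat}) : 'rV[int]_n :=
  \row_i (f i)%:Z.

Definition in_row_lattice (n : nat) (Delta : 'M[int]_n) (v : 'rV[int]_n) :
    Prop :=
  exists c : 'I_n -> int, v = \sum_i c i *: row i Delta.

(* Main.v *)
Require Import Defs.
From mathcomp Require Import all_boot all_order all_algebra.

(** If f' - f = c Delta then c Delta <= f' entrywise, because f >= 0. A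
    parking function f' only dominates c Delta when c <= 0. For c <= r with a
    positive entry, take chi to be the positive part of c: at an index j with
    chi(j) > 0, replacing c by chi can only decrease the pairing with column j,
    as it changes off-diagonal contributions alone, so chi violates the parking
    condition. For general c, subtract multiples of r, which preserves
    c Delta <= f' since r Delta >= 0. Exchanging f and f' gives -c <= 0, so
    c = 0. *)

Import Order.TTheory GRing.Theory Num.Theory.
Local Open Scope ring_scope.

Lemma in_row_latticeP (n : nat) (Delta : 'M[int]_n) (v : 'rV[int]_n) :
  in_row_lattice Delta v <-> exists c : 'rV[int]_n, v = c *m Delta.
Proof.
split=> [[c ->]|[c ->]].
  exists (\row_i c i); rewrite mulmx_sum_row.
  by apply: eq_bigr => i _; rewrite mxE.
by exists (c 0); rewrite mulmx_sum_row.
Qed.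

Lemma pairing_col (n : nat) (Delta : 'M[int]_n) (x : 'rV[int]_n) (j : 'I_n) :
  pairing x (col j Delta) = (x *m Delta) 0 j.
Proof. by rewrite /pairing mxE; apply: eq_bigr => i _; rewrite mxE. Qed.

Definition pos_part {n : nat} (c : 'rV[int]_n) : 'rV[int]_n :=
  \row_i Num.max (c 0 i) 0.

Lemma pos_part_mulmx_le {n : nat} {Delta : 'M[int]_n} {c : 'rV[int]_n}
    {j : 'I_n} :
  (forall i j : 'I_n, i <> j -> Delta i j <= 0) -> 0 < c 0 j ->
  (pos_part c *m Delta) 0 j <= (c *m Delta) 0 j.
Proof.
move=> offdiag cj_gt0; rewrite !mxE; apply: ler_sum => i _; rewrite mxE.
have [-> | /eqP neq_ij] := eqVneq i j; first by rewrite max_l ?lexx ?ltW.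
by rewrite ler_wnM2r ?offdiag ?le_max ?lexx.
Qed.

(** The bound by [r] is what places [pos_part c] among the vectors tested by the parking condition;
    where [c] is negative, [r > 0] gives the upper bound. *)
Lemma parking_dominates_le0_bounded {n : nat} {Delta : 'M[int]_n}
    {r : 'rV[int]_n} {f : {ffun 'I_n -> nat}}
    (offdiag : forall i j : 'I_n, i <> j -> Delta i j <= 0)
    (rR : in_R Delta r) (pf : parking_function Delta r f)
    (c : 'rV[int]_n) :
  vec_ge r c -> vec_ge (vec_of_fun f) (c *m Delta) -> vec_ge 0 c.
Proof.
move=> c_le_r cD_le i; rewrite [X in _ <= X]mxE leNgt; apply/negP => ci_gt0.
have chiO : in_Omega r (pos_part c).
  split=> [k|]; last by exists i; rewrite mxE max_l ?ltW // gt_eqF.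
  by rewrite mxE le_max lexx orbT ge_max c_le_r ltW // (proj1 rR).
have [j [chij /andP[_]]] := pf _ chiO.
(* A maximum with 0 that is at least 1 must be attained by the entry of [c]. *)
have cj_gt0 : 0 < c 0 j.
  by move: chij; rewrite mxE le_max orbF -gtz0_ge1.
have := cD_le j; rewrite [X in _ <= X]mxE => cD_lej.
by rewrite pairing_col ltNge (le_trans (pos_part_mulmx_le offdiag cj_gt0)).
Qed.

Lemma parking_dominates_le0 {n : nat} {Delta : 'M[int]_n}
    {r : 'rV[int]_n} {f : {ffun 'I_n -> nat}}
    (offdiag : forall i j : 'I_n, i <> j -> Delta i j <= 0)
    (rR : in_R Delta r) (pf : parking_function Delta r f)
    (c : 'rV[int]_n) :
  vec_ge (vec_of_fun f) (c *m Delta) -> vec_ge 0 c.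
Proof.
have [r_gt0 rD_ge0] := rR.
(* Induction on the number of copies of [r] that bound [c], with [c] varying because the step passes
   to [c - r]. *)
have main N : forall c : 'rV[int]_n, vec_ge (r *+ N) c ->
    vec_ge (vec_of_fun f) (c *m Delta) -> vec_ge 0 c.
  elim: N => [|N IH] {}c c_le cD_le; first by rewrite mulr0n in c_le.
  apply: (parking_dominates_le0_bounded offdiag rR pf) => // i.
  (* The induction hypothesis at [c - r] yields [c <= r], exactly what the bounded case asks for. *)
  have /(_ i) : vec_ge 0 (c - r).
    apply: IH => j.
      by have := c_le j; rewrite mulrS !mxE lerBlDl.
    rewrite mulmxBl; apply: le_trans (cD_le j).
    rewrite [leLHS]mxE [X in _ + X]mxE gerBl.
    by have := rD_ge0 j; rewrite [X in X <= _]mxE.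
  by rewrite !mxE subr_le0.
(* This sum bounds every entry of [c], and integrality gives [r] entries at least 1, so that many
   copies of [r] suffice. *)
apply: (main (\sum_i absz (c 0%R i))%N) => i.
rewrite mulmxnE -mulr_natl; have ri_ge1 : 1 <= r 0 i by rewrite -gtz0_ge1.
apply: (@le_trans _ _ (\sum_i absz (c 0%R i))%N%:R); last by rewrite ler_peMr.
rewrite (bigD1 i) //= natrD natz abszE.
by apply: le_trans (ler_norm _) _; rewrite lerDl.
Qed.

Theorem lemma2p9 (n : nat) (n_ge1 : (1 <= n)%N) (Delta : 'M[int]_n)
    (detDelta : \det Delta <> 0)
    (offdiag : forall i j : 'I_n, i <> j -> Delta i j <= 0)
    (exR : exists r : 'rV[int]_n, vec_pos r /\ vec_ge (r *m Delta) 0)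
    (r : 'rV[int]_n) (rR : in_R Delta r)
    (f f' : {ffun 'I_n -> nat})
    (pf : parking_function Delta r f) (pf' : parking_function Delta r f') :
  in_row_lattice Delta (vec_of_fun f' - vec_of_fun f) -> f' = f.
Proof.
move=> /in_row_latticeP[c def_c].
have c_le0 : vec_ge 0 c.
  apply: (parking_dominates_le0 offdiag rR pf') => i.
  by rewrite -def_c !mxE gerBl.
have c_ge0 : vec_ge 0 (- c).
  apply: (parking_dominates_le0 offdiag rR pf) => i.
  by rewrite mulNmx -def_c opprB !mxE gerBl.
have c0 : c = 0.
  apply/rowP => i; apply/eqP; rewrite eq_le c_le0 /=.
  by have := c_ge0 i; rewrite !mxE oppr_le0.
move/eqP: def_c; rewrite c0 mul0mx subr_eq0 => /eqP/rowP eq_ff'.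
by apply/ffunP => i; have := eq_ff' i; rewrite !mxE => -[].
Qed.
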